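(* Let $J=[0,\infty)$, let $f:J\to\mathbb{R}$ be a function that is differentiable on $J^{\circ}=(0,\infty)$, and let $a,b\in J$ with $0<a<b$ and $f'\in L[a,b]$. Let $q\ge 1$. If $|f'|^{q}$ is convex on $[a,b]$, then $$\left|\frac{1}{b-a}\int_{a}^{b}f(x)\,dx+\frac{a f(b)-b f(a)}{2(b-a)}-\frac12 f\left(\frac{a+b}{2}\right)\right|$$ $$\le\frac{A(a,b)^{1-\frac1q}}{4\cdot 12^{1/q}}\left\{\bigl[|f'(b)|^{q}(2a+b)+|f'(a)|^{q}(4a+5b)\bigr]^{1/q}+\bigl[|f'(a)|^{q}(a+2b)+|f'(b)|^{q}(5a+4b)\bigr]^{1/q}\right\}.$$
   Context: $L[a,b]$ denotes the space of (Lebesgue) integrable functions on $[a,b]$, and $A(a,b)=\frac{a+b}{2}$ is the arithmetic mean. *)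

(* Defs.v *)
From HB Require Import structures.
From mathcomp Require Import all_boot all_order all_algebra.
From mathcomp Require Import all_classical all_reals all_analysis.

Set Implicit Arguments.
Unset Strict Implicit.
Unset Printing Implicit Defensive.

Import Order.TTheory GRing.Theory Num.Theory.
Import numFieldNormedType.Exports.

Local Open Scope ring_scope.

Definition arith_mean (R : realType) (a b : R) : R := (a + b) / 2.

(* Main.v *)
(* Put m = (a + b) / 2 and let F be an antiderivative of f. On a half [l, r] of
   [a, b] the function (c - x) f(x) + F(x) has derivative (c - x) f'(x);
   taking c = (2a + b) / 2 on [a, m] and c = (a + 2b) / 2 on [m, b], the two
   increments add up to b - a times the left-hand side. Convexity bounds
   |f'|^q by its chord, and a tangent line of the concave map y |-> y^(1/q)
   turns this into an affine bound on |f'|. The increment is then dominated,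
   through the mean value theorem, by that of an explicit cubic polynomial;
   no integral of f' is needed. Choosing the tangent point optimally
   reproduces the power-mean inequality on each half. *)
Require Import Defs.
From HB Require Import structures.
From mathcomp Require Import all_boot all_order all_algebra.
From mathcomp Require Import all_classical all_reals all_analysis.
From mathcomp Require Import ring lra.

Set Implicit Arguments.
Unset Strict Implicit.
Unset Printing Implicit Defensive.

Import Order.TTheory GRing.Theory Num.Theory.
Import numFieldNormedType.Exports.

Local Open Scope ring_scope.
Local Open Scope classical_set_scope.

(** * Weighted estimates on a single interval *)

Lemma eq_ler (R : realType) (x y : R) : x = y -> x <= y.
Proof. by move->. Qed.

(** Both [h - g] and [h + g] have a nonnegative derivative, so the mean value theorem makes both
    increments nonnegative. *)
Lemma derive_dominated_increment (R : realType) (g g' h h' : R -> R) (l r : R) :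
  l <= r ->
  {in `[l, r]%R, forall x : R, is_derive x 1 g (g' x)} ->
  {in `[l, r]%R, forall x : R, is_derive x 1 h (h' x)} ->
  {in `[l, r]%R, forall x : R, `|g' x| <= h' x} ->
  `|g r - g l| <= h r - h l.
Proof.
move=> lr dg dh gh.
have oc x : x \in `]l, r[%R -> x \in `[l, r]%R by exact: subset_itv_oo_cc.
have cont (k k' : R -> R) : {in `[l, r]%R, forall x : R, is_derive x 1 k (k' x)} ->
    {within `[l, r], continuous k}.
  by move=> dk; apply: derivable_within_continuous => x /dk [].
have dD x : x \in `[l, r]%R -> is_derive x 1 (h + g) (h' x + g' x).
  by move=> xlr; apply: is_deriveD; [exact: dh|exact: dg].
have dB x : x \in `[l, r]%R -> is_derive x 1 (h - g) (h' x - g' x).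
  by move=> xlr; apply: is_deriveB; [exact: dh|exact: dg].
have [x xlr] := MVT_segment lr (fun x xlr => dB x (oc x xlr)) (cont _ _ dB).
have [y ylr] := MVT_segment lr (fun x xlr => dD x (oc x xlr)) (cont _ _ dD).
rewrite !fctE => ey ex.
move: (gh x xlr) (gh y ylr); rewrite !ler_norml => /andP[_ gx] /andP[gy _].
have := mulr_ge0 (_ : 0 <= h' x - g' x) (_ : 0 <= r - l).
have := mulr_ge0 (_ : 0 <= h' y + g' y) (_ : 0 <= r - l).
by rewrite -ey -ex => H1 H2; apply/andP; split;
  [have := H1 ltac:(lra) ltac:(lra)|have := H2 ltac:(lra) ltac:(lra)]; lra.
Qed.

(** The right-hand side is the integral over [[l, r]] of the kernel [c - x] times the affine
    function with endpoint values [U] and [V]; [r <= c] keeps the kernel nonnegative. *)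
Lemma kernel_linear_bound (R : realType) (f F : R -> R) (c l r U V : R) :
  l < r -> r <= c ->
  {in `[l, r]%R, forall x : R, derivable f x 1} ->
  {in `[l, r]%R, forall x : R, is_derive x 1 F (f x)} ->
  {in `[l, r]%R, forall x : R,
    `|f^`() x| <= (U * (r - x) + V * (x - l)) / (r - l)} ->
  `|(c - r) * f r - (c - l) * f l + (F r - F l)| <=
    (r - l) * ((c - l) * (2 * U + V) + (c - r) * (U + 2 * V)) / 6.
Proof.
move=> lr rc df dF f'le.
have rl0 : r - l != 0 by rewrite subr_eq0 gt_eqF.
(* The affine bound in monomial form is [u + v * x], and [h] is the cubic with derivative
   [(c - x) * (u + v * x)]. *)
pose u := (U * r - V * l) / (r - l).
pose v := (V - U) / (r - l).
pose g x := (c - x) * f x + F x.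
pose h x := c * u * x + (c * v - u) / 2 * x ^+ 2 - v / 3 * x ^+ 3.
have dg : {in `[l, r]%R, forall x : R, is_derive x 1 g ((c - x) * f^`()%classic x)}.
  move=> x xlr; have := dF x xlr => dFx.
  have dfx : is_derive x 1 f (f^`()%classic x).
    by rewrite derive1E; apply/derivableP/df.
  by apply: is_derive_eq; rewrite /GRing.scale/=; ring.
have dh : {in `[l, r]%R, forall x : R, is_derive x 1 h ((c - x) * (u + v * x))}.
  move=> x _.
  by apply: is_derive_eq; rewrite /GRing.scale/=; field.
have gh : {in `[l, r]%R, forall x : R,
    `|(c - x) * f^`()%classic x| <= (c - x) * (u + v * x)}.
  move=> x xlr; move: (xlr); rewrite in_itv/= => /andP[lx xr].
  rewrite normrM ger0_norm ?subr_ge0 ?(le_trans xr)// ler_wpM2l ?subr_ge0 ?(le_trans xr)//.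
  apply: le_trans (f'le x xlr) _.
  by apply: eq_ler; rewrite /u /v; field.
have := derive_dominated_increment (ltW lr) dg dh gh.
rewrite (_ : g r - g l = (c - r) * f r - (c - l) * f l + (F r - F l)); last first.
  by rewrite /g; ring.
move/le_trans; apply.
by apply: eq_ler; rewrite /h /u /v; field.
Qed.

(* The right-hand side is the tangent line of the concave function
   [y |-> y `^ q^-1] at [y = t `^ q], evaluated at [z `^ q]. *)
Lemma le_powR_tangent (R : realType) (q t z : R) :
  1 <= q -> 0 < t -> 0 <= z ->
  z <= t * (1 - q^-1) + t / (q * t `^ q) * z `^ q.
Proof.
move=> q1 t0 z0.
have tq0 : 0 < t `^ q by rewrite powR_gt0.
have q0 : 0 < q by lra.
(* For [q = 1] the conjugate exponent would be infinite, but both sides then equal [z]. *)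
move: q1; rewrite le_eqVlt => /predU1P[<-|q1].
  by rewrite !powRr1 ?(ltW t0)// invr1 subrr mulr0 add0r mul1r divff ?mul1r// gt_eqF.
have iq1 : q^-1 < 1 by rewrite invf_lt1.
have zt0 : 0 <= z / t by rewrite divr_ge0// ltW.
have p0 : 0 < (1 - q^-1)^-1 by rewrite invr_gt0 subr_gt0.
(* Young's inequality for the product of [z / t] and [1], with exponents [q] and [(1 - q^-1)^-1]. *)
have := conjugate_powR zt0 ler01 q0 p0.
rewrite invrK subrKC mulr1 powR1 mul1r => /(_ erefl).
rewrite ler_pdivrMr// => /le_trans; apply.
rewrite powRM ?invr_ge0 ?(ltW t0)// -powR_inv1 ?(ltW t0)// -powRrM mulN1r powRN.
by apply: eq_ler; field; rewrite !gt_eqF.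
Qed.

(** This is the power-mean inequality: the two bases on the right are the integrals of the kernel
    [c - x] and of the kernel times the affine bound on [|f'|^q]. *)
Lemma kernel_power_mean_bound (R : realType) (f F : R -> R) (c l r q U V : R) :
  l < r -> r < c -> 1 <= q ->
  {in `[l, r]%R, forall x : R, derivable f x 1} ->
  {in `[l, r]%R, forall x : R, is_derive x 1 F (f x)} ->
  {in `[l, r]%R, forall x : R,
    `|f^`() x| `^ q <= (U * (r - x) + V * (x - l)) / (r - l)} ->
  `|(c - r) * f r - (c - l) * f l + (F r - F l)| <=
    ((r - l) * ((c - l) + (c - r)) / 2) `^ (1 - q^-1)
    * ((r - l) * ((c - l) * (2 * U + V) + (c - r) * (U + 2 * V)) / 6) `^ q^-1.
Proof.
move=> lr rc q1 df dF f'le.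
have q0 : 0 < q by lra.
have rl0 : 0 < r - l by lra.
have U0 : 0 <= U.
  have := f'le l; rewrite in_itv/= lexx ltW// => /(_ isT).
  by rewrite subrr mulr0 addr0 mulfK ?gt_eqF//; apply: le_trans; exact: powR_ge0.
have V0 : 0 <= V.
  have := f'le r; rewrite in_itv/= lexx ltW// => /(_ isT).
  by rewrite subrr mulr0 add0r mulfK ?gt_eqF//; apply: le_trans; exact: powR_ge0.
set W := _ * _ / 2; set X := _ * _ / 6.
have W0 : 0 < W by rewrite /W divr_gt0// mulr_gt0//; lra.
have X0 : 0 <= X.
  by rewrite /X divr_ge0// (mulr_ge0 (ltW rl0))// addr_ge0// mulr_ge0//; lra.
(* If [U + V = 0], the tangent point would degenerate to [0]; but [f'] vanishes on [[l, r]], so the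
   linear bound with zero endpoint values suffices. *)
have [UV0|UV0] := eqVneq (U + V) 0.
  have [UE VE] : U = 0 /\ V = 0 by split; lra.
  apply: (@le_trans _ _ 0); last by rewrite mulr_ge0 ?powR_ge0.
  rewrite (_ : 0 = (r - l) * ((c - l) * (2 * 0 + 0) + (c - r) * (0 + 2 * 0)) / 6); last by ring.
  apply: kernel_linear_bound => // [|x xlr]; first exact: ltW.
  have := f'le x xlr; rewrite UE VE !mul0r addr0 mul0r => h.
  by have /eqP := le_anti (introT andP (conj h (powR_ge0 _ _))); rewrite powR_eq0 => /andP[/eqP ->].
have {}X0 : 0 < X.
  have UVgt0 : 0 < U + V by rewrite lt_def UV0 addr_ge0.
  rewrite /X divr_gt0// mulr_gt0// ltr_pwDl//; last by rewrite mulr_ge0//; lra.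
  by rewrite mulr_gt0//; lra.
(* The tangent point [X / W] makes the linear estimate equal to the
   power-mean bound [W `^ (1 - q^-1) * X `^ q^-1]. *)
pose y := X / W.
have y0 : 0 < y by rewrite divr_gt0.
pose t := y `^ q^-1.
have t0 : 0 < t by rewrite powR_gt0.
have tq : t `^ q = y by rewrite /t -powRrM mulVf ?gt_eqF// powRr1// ltW.
pose al := t * (1 - q^-1).
pose be := t / (q * y).
have be0 : 0 <= be by rewrite divr_ge0 ?(ltW t0)// mulr_ge0 ?(ltW q0) ?(ltW y0).
have bnd : {in `[l, r]%R, forall x : R, `|f^`() x| <=
    ((al + be * U) * (r - x) + (al + be * V) * (x - l)) / (r - l)}.
  move=> x xlr; apply: le_trans (le_powR_tangent q1 t0 (normr_ge0 _)) _.
  rewrite tq -/al -/be.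
  apply: le_trans (lerD (lexx al) (ler_wpM2l be0 (f'le x xlr))) _.
  by apply: eq_ler; field; rewrite gt_eqF.
apply: le_trans (kernel_linear_bound lr (ltW rc) df dF bnd) _.
have -> : W `^ (1 - q^-1) * X `^ q^-1 = W * t.
  rewrite /t /y powRB ?(gt_eqF W0) ?implybT// powRr1 ?ltW//.
  rewrite (@powRM _ X W^-1) ?invr_ge0 ?ltW// -(powR_inv1 (ltW W0)) -powRrM mulN1r powRN.
  by field; rewrite ?gt_eqF ?powR_gt0.
(* The tangent line with coefficients [al] and [be] takes the value [t] at its contact point
   [y = X / W]. *)
have -> : W * t = al * W + be * X.
  by rewrite /al /be /y; field; rewrite !gt_eqF.
by apply: eq_ler; rewrite /W /X; field.
Qed.

(** * Antiderivatives, chords and rescaling of real powers *)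

Lemma continuous_antiderivative (R : realType) (f : R -> R) (a b : R) :
  0 < a -> a < b -> {in `]0, +oo[%R, continuous f} ->
  exists2 F : R -> R,
    {in `[a, b]%R, forall x : R, is_derive x 1 F (f x)} &
    \int[lebesgue_measure]_(x in `[a, b]) f x = F b - F a.
Proof.
move=> a0 ab cf.
(* Widening the interval makes [a] and [b] interior points, so [F] has two-sided derivatives there;
   [a / 2] is still positive. *)
pose a' := a / 2; pose b' := b + 1.
have sub x : x \in `[a', b']%R -> x \in `]0, +oo[%R.
  by rewrite !in_itv/= andbT /a' => /andP[+ _]; lra.
have cw : {within `[a', b'], continuous f}.
  apply: continuous_in_subspaceT => x; rewrite inE/= => xab.
  exact/cf/sub.
pose F x := \int[lebesgue_measure]_(t in `[a', x]) f t.
have dF : {in `[a, b]%R, forall x : R, is_derive x 1 F (f x)}.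
  move=> x; rewrite in_itv/= => /andP[ax xb].
  have a'x : a' < x by rewrite /a'; lra.
  have xb' : x < b' by rewrite /b'; lra.
  have fi : lebesgue_measure.-integrable `[a', b'] (EFin \o f).
    by apply: continuous_compact_integrable => //; exact: segment_compact.
  have cx : {for x, continuous f}.
    by apply: cf; rewrite in_itv/= andbT; lra.
  have [Fx <-] := continuous_FTC1_closed xb' fi a'x cx.
  by rewrite derive1E; exact/derivableP.
exists F => //.
have cF : {within `[a, b], continuous F}.
  by apply: derivable_within_continuous => x /dF [].
have [_ Fa Fb] := (continuous_within_itvP F ab).1 cF.
rewrite /Rintegral (continuous_FTC2 ab (F := F))//.
- apply: continuous_subspaceW cw => x /=; rewrite !in_itv/= /a' /b' => /andP[? ?].
  by apply/andP; split; lra.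
- by split => // x /subset_itv_oo_cc/dF [].
- by move=> x /subset_itv_oo_cc/dF dFx; rewrite derive1E derive_val.
Qed.

Lemma convex_function_chord (R : realType) (g : R -> R) (a b : R) :
  a < b -> @convex_function R R^o `[a, b] g ->
  {in `[a, b]%R, forall x : R, g x <= (g a * (b - x) + g b * (x - a)) / (b - a)}.
Proof.
move=> ab cvx x; rewrite in_itv/= => /andP[ax xb].
have ba0 : 0 < b - a by lra.
have t01 : 0 <= (b - x) / (b - a) <= 1.
  by rewrite divr_ge0 ?ler_pdivrMr//=; lra.
have ain : a \in (`[a, b] : set R) by rewrite inE/= in_itv/= lexx ltW.
have bin : b \in (`[a, b] : set R) by rewrite inE/= in_itv/= lexx ltW.
pose t : {i01 R} := Itv01 (proj1 (andP t01)) (proj2 (andP t01)).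
have tx : conv t (a : convex_lmodType R^o) b = x :> R.
  rewrite (convRE a b t : conv t (a : convex_lmodType R^o) b = _)/= /unstable.onem.
  by field; rewrite gt_eqF.
have := cvx t a b ain bin.
rewrite tx convRE/= /unstable.onem => /le_trans; apply.
by apply: eq_ler; field; rewrite gt_eqF.
Qed.

Lemma powR_div (R : realType) (x y s : R) :
  0 <= x -> 0 <= y -> (x / y) `^ s = x `^ s / y `^ s.
Proof.
move=> x0 y0; rewrite powRM ?invr_ge0//.
by rewrite -(powR_inv1 y0) -powRrM mulN1r powRN.
Qed.

(** The exponents add up to [1], so [d] comes out to the first power, and [48 = 4 * 12] leaves a
    full factor [4] beside the root of [12]. *)
Lemma powR_rescale (R : realType) (q d M Y : R) :
  0 < d -> 0 <= M -> 0 <= Y ->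
  (d * (M / 4)) `^ (1 - q^-1) * (d * (Y / 48)) `^ q^-1 =
  d * (M `^ (1 - q^-1) / (4 * 12 `^ q^-1) * Y `^ q^-1).
Proof.
move=> d0 M0 Y0.
have split1 (z : R) : 0 < z -> z `^ (1 - q^-1) = z / z `^ q^-1.
  by move=> z0; rewrite powRB ?(gt_eqF z0) ?implybT// powRr1// ltW.
rewrite [(d * (M / 4)) `^ _]powRM ?divr_ge0 ?(ltW d0)//.
rewrite [(d * (Y / 48)) `^ _]powRM ?divr_ge0 ?(ltW d0)//.
rewrite (powR_div _ M0)// (powR_div _ Y0)//.
rewrite (split1 _ d0) (split1 4)//.
rewrite (_ : 48 = 4 * 12); last by ring.
rewrite [(4 * 12) `^ _]powRM//.
by field; rewrite !gt_eqF ?powR_gt0.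
Qed.

(** * Combination of the two halves *)

Theorem theorem7 (R : realType) (f : R -> R) (a b q : R)
    (f_diff : {in `]0, +oo[, forall x : R, derivable f x 1})
    (a_gt0 : 0 < a) (a_lt_b : a < b)
    (f'_int : lebesgue_measure.-integrable `[a, b] (EFin \o f^`()))
    (q_ge1 : 1 <= q)
    (f'_conv : @convex_function R R^o `[a, b] (fun x : R => `|f^`() x| `^ q)) :
  `| (b - a)^-1 * (\int[lebesgue_measure]_(x in `[a, b]) f x)
     + (a * f b - b * f a) / (2 * (b - a))
     - 2^-1 * f ((a + b) / 2) |
  <= arith_mean a b `^ (1 - q^-1) / (4 * 12 `^ q^-1)
     * ((`|f^`() b| `^ q * (2 * a + b)
         + `|f^`() a| `^ q * (4 * a + 5 * b)) `^ q^-1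
        + (`|f^`() a| `^ q * (a + 2 * b)
           + `|f^`() b| `^ q * (5 * a + 4 * b)) `^ q^-1).
Proof.
have q0 : 0 < q by lra.
have df : {in `[a, b]%R, forall x : R, derivable f x 1}.
  move=> x; rewrite in_itv/= => /andP[ax _].
  by apply: f_diff; rewrite inE/= in_itv/= andbT; lra.
have cf : {in `]0, +oo[%R, continuous f}.
  move=> x x0; apply: differentiable_continuous; apply/derivable1_diffP.
  by apply: f_diff; rewrite inE.
have [F dF ->] := continuous_antiderivative a_gt0 a_lt_b cf.
have := convex_function_chord a_lt_b f'_conv.
set A := `|f^`() a| `^ q; set B := `|f^`() b| `^ q => chord.
have A0 : 0 <= A by exact: powR_ge0.
have B0 : 0 <= B by exact: powR_ge0.
clearbody A B.
set m := (a + b) / 2.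
have ba0 : 0 < b - a by lra.
have subl (x : R) : x \in `[a, m]%R -> x \in `[a, b]%R.
  by rewrite !in_itv/= /m => /andP[? ?]; apply/andP; split; lra.
have subr (x : R) : x \in `[m, b]%R -> x \in `[a, b]%R.
  by rewrite !in_itv/= /m => /andP[? ?]; apply/andP; split; lra.
have am : a < m by rewrite /m; lra.
have mb : m < b by rewrite /m; lra.
(* Since [a > 0], each kernel [c - x] is positive up to the right end of its half. *)
have mc : m < (2 * a + b) / 2 by rewrite /m; lra.
have bc : b < (a + 2 * b) / 2 by lra.
(* The chord of [|f'|^q] takes the value [(A + B) / 2] at the midpoint, which serves as endpoint
   value for both halves. *)
have left_half := @kernel_power_mean_bound _ f F _ _ _ _ A ((A + B) / 2) am mc q_ge1
  (fun x xam => df x (subl x xam)) (fun x xam => dF x (subl x xam)).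
have right_half := @kernel_power_mean_bound _ f F _ _ _ _ ((A + B) / 2) B mb bc q_ge1
  (fun x xmb => df x (subr x xmb)) (fun x xmb => dF x (subr x xmb)).
have M0 : 0 <= arith_mean a b by rewrite /arith_mean; lra.
have SL0 : 0 <= B * (2 * a + b) + A * (4 * a + 5 * b).
  by apply: addr_ge0; rewrite mulr_ge0//; clear -a_gt0 a_lt_b; lra.
have SR0 : 0 <= A * (a + 2 * b) + B * (5 * a + 4 * b).
  by apply: addr_ge0; rewrite mulr_ge0//; clear -a_gt0 a_lt_b; lra.
rewrite [leRHS]mulrDr -(ler_pM2l ba0) [leRHS]mulrDr -!powR_rescale//.
rewrite -(ger0_norm (ltW ba0)) -normrM (ger0_norm (ltW ba0)).
pose k1 := (2 * a + b) / 2; pose k2 := (a + 2 * b) / 2.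
(* Here [k1 - m = k2 - b = a / 2] and [k1 - a = k2 - m = b / 2], so the [f m] terms combine to
   [- (b - a) / 2 * f m] and the [F m] terms cancel. *)
rewrite [X in `|X| <= _](_ : _ =
    ((k1 - m) * f m - (k1 - a) * f a + (F m - F a))
    + ((k2 - b) * f b - (k2 - m) * f m + (F b - F m))); last first.
  by rewrite /k1 /k2 /m; field; rewrite gt_eqF.
apply: le_trans (ler_normD _ _) _; apply: lerD.
- apply: le_trans (left_half _) _ => [x xam|].
    apply: le_trans (chord x (subl x xam)) _.
    by apply: eq_ler; rewrite /m; field; rewrite !gt_eqF//; lra.
  (* The kernel has integral [(b - a) * (a + b) / 8] on either half, which is [b - a] times a
     quarter of the mean. *)
  by apply: eq_ler; congr (_ `^ _ * _ `^ _);
    rewrite /m /arith_mean; field.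
- apply: le_trans (right_half _) _ => [x xmb|].
    apply: le_trans (chord x (subr x xmb)) _.
    by apply: eq_ler; rewrite /m; field; rewrite !gt_eqF//; lra.
  by apply: eq_ler; congr (_ `^ _ * _ `^ _);
    rewrite /m /arith_mean; field.
Qed.
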